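(* Let $\rho$ be either smooth tempered of exponential type or Gaussian, $\rho(x)=\beta e^{-\alpha|x|^2}$. There exists $C>0$ such that for every $n\in\mathbb N$, $h\in(0,1]$, $\tau>0$ and every $x\in\mathbb R^d$ with $|x|\ge\tau+(n+1)h$, $$\|T_h^n(x,dy)-d\nu_h\|_{TV}\ge1-Cp(\tau),$$ where $p(\tau)=e^{-2\alpha\tau(\tau-h)}$ in the Gaussian case and $p(\tau)=\int_{|y|\ge\tau}\rho(y)^2dy$ in the tempered case.
   Context: $\rho\in C^1(\mathbb R^d)$ strictly positive, bounded, $\int\rho\,dx=1$. Smooth tempered of exponential type means $\rho\in C^\infty$ and there are $C_\beta>0$, $R>0$, $\kappa_0>0$ with $|\partial^\beta\rho(x)|\le C_\beta\rho(x)$ for all $\beta$ and $\sum_i\partial_{x_i}^2\rho(x)\ge\kappa_0\rho(x)$ for $|x|\ge R$. $m_h(x)=\int_{|y-x|<h}\rho(y)dy$. $T_h$ is the Markov operator $T_hf(x)=\frac1{m_h(x)}\int_{|y-x|<h}f(y)\rho(y)dy$, with kernel $t_h(x,dy)=\frac{\rho(y)}{m_h(x)}\mathbf 1_{|x-y|<h}dy$; $T_h^n(x,dy)$ is the $n$-step kernel. $d\nu_h=Z_h^{-1}m_h(x)\rho(x)dx$ is the stationary probability measure ($Z_h$ normalizing). For probability measures, $\|\mu-\nu\|_{TV}=\sup_A|\mu(A)-\nu(A)|$ over measurable $A$. *)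

(* Defs.v *)
From HB Require Import structures.
From mathcomp Require Import all_boot all_order all_algebra.
From mathcomp Require Import all_classical all_reals all_analysis.
Set Implicit Arguments. Unset Strict Implicit. Unset Printing Implicit Defensive.
Import Order.TTheory GRing.Theory Num.Theory.
Import numFieldNormedType.Exports.
Local Open Scope classical_set_scope.
Local Open Scope ring_scope.

Section Defs.
Variable R : realType.

(* Lebesgue measure on R^n, defined as the iterated integral (Tonelli)
   lebd n A = \int (\int ... 1_A(t1,...,tn) dtn ...) dt1 *)
Fixpoint lebd (n : nat) : set (n.-tuple R) -> \bar R :=
  match n return set (n.-tuple R) -> \bar R with
  | 0 => fun A => ((\1_A ([tuple] : 0.-tuple R)) : R)%:E
  | m.+1 => fun A =>
      (\int[@lebesgue_measure R]_t (@lebd m [set x | A (cons_tuple t x)]))%E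
  end.
Arguments lebd : clear implicits.

Variable n : nat.
Implicit Types (x y : n.-tuple R) (f : n.-tuple R -> R).

Definition tsub x y : n.-tuple R := [tuple tnth x i - tnth y i | i < n].
Definition enorm x : R := Num.sqrt (\sum_(i < n) tnth x i ^+ 2).

Definition eball x (h : R) : set (n.-tuple R) := [set y | enorm (tsub y x) < h].

Definition econtinuous f : Prop :=
  forall x (e : R), 0 < e ->
    exists2 del : R, 0 < del & forall y, enorm (tsub y x) < del -> `|f y - f x| < e.

Definition tupd x (i : 'I_n) (t : R) : n.-tuple R :=
  [tuple if j == i then t else tnth x j | j < n].

Definition partial_derivable (i : 'I_n) f x : Prop :=
  derivable (fun t : R => f (tupd x i t)) (tnth x i) 1.
Definition partial (i : 'I_n) f : n.-tuple R -> R :=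
  fun x => derive1 (fun t : R => f (tupd x i t)) (tnth x i).

Definition dmulti (b : 'I_n -> nat) f : n.-tuple R -> R :=
  foldr (fun i g => iter (b i) (partial i) g) f (enum 'I_n).

Definition C1 f : Prop :=
  econtinuous f /\
  forall i, (forall x, partial_derivable i f x) /\ econtinuous (partial i f).

Definition smooth f : Prop :=
  forall s : seq 'I_n,
    econtinuous (foldr partial f s) /\
    forall i x, partial_derivable i (foldr partial f s) x.

Definition tempered_exp f : Prop :=
  smooth f /\
  (forall b : 'I_n -> nat, exists2 C : R, 0 < C &
      forall x, `|dmulti b f x| <= C * f x) /\
  (exists Rr kappa0 : R, [/\ 0 < Rr, 0 < kappa0 &
      forall x, Rr <= enorm x ->
        kappa0 * f x <= \sum_(i < n) partial i (partial i f) x]).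

Definition mh f (h : R) x : R :=
  fine (\int[lebd n]_(y in eball x h) (f y)%:E)%E.

Fixpoint Tn f (h : R) (k : nat) (x : n.-tuple R) (A : set (n.-tuple R)) : R :=
  match k with
  | 0 => \1_A x
  | k'.+1 => (mh f h x)^-1 *
      fine (\int[lebd n]_(y in eball x h) (f y * Tn f h k' y A)%:E)%E
  end.

Definition Zh f (h : R) : R := fine (\int[lebd n]_y (mh f h y * f y)%:E)%E.
Definition nuh f (h : R) (A : set (n.-tuple R)) : R :=
  (Zh f h)^-1 * fine (\int[lebd n]_(y in A) (mh f h y * f y)%:E)%E.

Definition tvdist (mu nu : set (n.-tuple R) -> R) : \bar R :=
  ereal_sup [set (`|mu A - nu A|)%:E | A in [set A : set (n.-tuple R) | measurable A]].

End Defs.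
Arguments lebd {R} n.

(* Main.v *)
Require Import Defs.
From HB Require Import structures.
From mathcomp Require Import all_boot all_order all_algebra.
From mathcomp Require Import all_classical all_reals all_analysis.
From mathcomp Require Import measurable_realfun ring lra.
Set Implicit Arguments. Unset Strict Implicit. Unset Printing Implicit Defensive.
Import Order.TTheory GRing.Theory Num.Theory.
Import numFieldNormedType.Exports.
Local Open Scope classical_set_scope.
Local Open Scope ring_scope.

(** The n-step measure started at x lives in the ball of radius n h about x.
    If phi is 1-Lipschitz and [phi x >= tau + (n+1) h], that ball lies in
    [A = {phi >= tau + h}], so the total variation distance is at least
    [1 - nu_h(A)], and [Z_h >= c h^d] reduces the claim to an upper bound on
    the integral of [m_h rho] over A, of order [h^d p(tau)].

    Tempered case, [phi y = |y|]: the bounds on the first derivatives make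
    [ln rho] Lipschitz, so [m_h <= L (2h)^d rho].

    Gaussian case, [phi y = <e, y>] with [e = x / |x|]: the half-space, unlike
    the complement of a ball, gives no power of tau.  On A, with
    [s = tau + h], one has [|y|^2 >= s^2 + |y - s e|^2], while
    [<e, z> >= tau] for z within h of y, so that
    [m_h(y) <= beta (2h)^d exp(- alpha tau^2)]. *)

(* The integral of a nonnegative function is a supremum over simple functions,
   so these bounds hold without measurability; in particular [m_h] and [rho]
   need not be shown measurable. *)
Section integral_without_measurability.
Context d (T : measurableType d) (R : realType).
Variable mu : {measure set T -> \bar R}.
Local Open Scope ereal_scope.
Import HBNNSimple.

Lemma ge0_le_integral_sub (D E : set T) (f g : T -> \bar R) :
  (forall x, D x -> 0 <= f x) -> (forall x, E x -> 0 <= g x) ->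
  (forall x, D x -> E x /\ f x <= g x) ->
  \int[mu]_(x in D) f x <= \int[mu]_(x in E) g x.
Proof.
move=> f0 g0 fg; rewrite !ge0_integralE//; apply: le_ereal_sup => _ [h hf <-].
exists h => // x; apply: (le_trans (hf x)); rewrite /patch.
case: ifPn => [/set_mem /fg[Ex fgx]|_]; first by rewrite mem_set.
by case: ifPn => // /set_mem/g0.
Qed.

(** A simple function below c f, scaled by 1/c, is a simple function below f, so it competes in the
    supremum that defines the integral of f. *)
Lemma ge0_integralZl_le (D : set T) (f : T -> \bar R) (c : R) : (0 < c)%R ->
  (forall x, D x -> 0 <= f x) ->
  \int[mu]_(x in D) (c%:E * f x) <= c%:E * \int[mu]_(x in D) f x.
Proof.
move=> c0 f0.
have cf0 x : D x -> 0 <= c%:E * f x by move=> /f0; apply: mule_ge0; rewrite lee_fin ltW.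
rewrite !ge0_integralE//; apply: ge_ereal_sup => _ [h hf <-].
have ci0 : (0 <= c^-1)%R by rewrite invr_ge0 ltW.
rewrite -lee_pdivrMl// -sintegralrM.
apply: ereal_sup_ubound; exists (scale_nnsfun h ci0) => //= x.
rewrite EFinM lee_pdivrMl//; apply: (le_trans (hf x)).
by rewrite /patch; case: ifP => //; rewrite mule0.
Qed.

End integral_without_measurability.

(** * Lebesgue measure on tuples as a sigma-finite measure, and Tonelli *)

Section lebd_measure.
Variable R : realType.
Local Open Scope ereal_scope.

Let consp n (p : R * n.-tuple R) : n.+1.-tuple R := cons_tuple p.1 p.2.

Let measurable_consp n : measurable_fun [set: measurableTypeR R * n.-tuple R] (@consp n).
Proof.
have := @measurable_cons _ _ (measurableTypeR R * n.-tuple R)%type R fst n snd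
  measurable_fst measurable_snd.
by apply: eq_measurable_fun => -[t x] _ /=; apply: val_inj.
Qed.

Let unconsp n (x : n.+1.-tuple R) : R * n.-tuple R :=
  (tnth x ord0, [tuple of behead x]).

Let measurable_unconsp n : measurable_fun [set: n.+1.-tuple R]
  (@unconsp n : _ -> measurableTypeR R * n.-tuple R).
Proof.
apply: measurable_fun_pair; first exact: measurable_tnth.
exact: measurable_behead.
Qed.

Let unconspK n (x : n.+1.-tuple R) : consp (unconsp x) = x.
Proof. by rewrite /consp/= [RHS]tuple_eta; apply: val_inj. Qed.

Let conspK n (p : R * n.-tuple R) : unconsp (consp p) = p.
Proof. by case: p => t x; rewrite /unconsp/consp/=; congr pair; apply: val_inj. Qed.

(** The successor case of [lebd] written as a product measure carried to tuples by [consp].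
    Sigma-finiteness is carried along because the next product needs it. *)
Definition lebdS n (m : {sigma_finite_measure set (n.-tuple R) -> \bar R}) :
    set (n.+1.-tuple R) -> \bar R :=
  pushforward (@lebesgue_measure R \x m) (@consp n).

Section lebdS.
Variables (n : nat) (m : {sigma_finite_measure set (n.-tuple R) -> \bar R}).

Let lebdS0 : lebdS m set0 = 0.
Proof. by apply: measure0; exact: measurable_consp. Qed.

Let lebdS_ge0 A : 0 <= lebdS m A.
Proof. by apply: measure_ge0; exact: measurable_consp. Qed.

Let lebdS_sigma_additive : semi_sigma_additive (lebdS m).
Proof. by apply: measure_semi_sigma_additive; exact: measurable_consp. Qed.

HB.instance Definition _ := isMeasure.Build _ _ _ (lebdS m)
  lebdS0 lebdS_ge0 lebdS_sigma_additive.

(* Canonical inference finds sigma-finiteness of [\x] only for subprobabilities. *)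
Let lebdS_sigma_finite : sigma_finite setT (lebdS m).
Proof.
have /sigma_finiteP[F [UF ndF mF]] := sigma_finiteT (@lebesgue_measure R).
have /sigma_finiteP[G [UG ndG mG]] := sigma_finiteT m.
exists (fun k => @unconsp n @^-1` (F k `*` G k)).
  apply/seteqP; split=> // x _.
  have [i _ Fi] : (\bigcup_i F i) (unconsp x).1 by rewrite -UF.
  have [j _ Gj] : (\bigcup_j G j) (unconsp x).2 by rewrite -UG.
  (* Both exhausting sequences are nondecreasing, so the larger index serves both coordinates. *)
  exists (maxn i j) => //; split.
    by apply: (subsetPset _ _ (ndF i _ _)) Fi; exact: leq_maxl.
  by apply: (subsetPset _ _ (ndG j _ _)) Gj; exact: leq_maxr.
move=> k; have [mFk Fk] := mF k; have [mGk Gk] := mG k; split.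
  rewrite -[X in measurable X]setTI; apply: measurable_unconsp => //.
  exact: measurableX.
rewrite /lebdS/= /pushforward/= -comp_preimage (_ : _ \o _ = id); last first.
  by apply/funext => p /=; exact: conspK.
by rewrite product_measure1E// lte_mul_pinfty// ge0_fin_numE.
Qed.

HB.instance Definition _ := Measure_isSigmaFinite.Build _ _ _
  (lebdS m) lebdS_sigma_finite.

End lebdS.

Lemma lebdS_E n (m : {sigma_finite_measure set (n.-tuple R) -> \bar R}) :
  lebd n = m -> lebd n.+1 = lebdS m.
Proof.
move=> mE; apply/funext => A; rewrite /lebdS/= mE /pushforward.
apply: eq_integral => t _; congr (m _); apply/seteqP; split=> x /=.
  by rewrite /xsection/= => Ax; rewrite mem_set.
by rewrite /xsection/= => /set_mem.
Qed.

(** [lebd] is only a set function by definition; rewriting it to such an m makes the theory of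
    measures and integrals applicable. *)
Lemma lebd_measure n :
  exists m : {sigma_finite_measure set (n.-tuple R) -> \bar R}, lebd n = m.
Proof.
elim: n => [|n [m mE]].
  by exists (\d_([tuple] : 0.-tuple R)); apply/funext => A /=; rewrite /dirac.
by exists (lebdS m); exact: lebdS_E.
Qed.

(** Change of variables along [consp], then Tonelli; this is the induction step for integrals over
    tuples. *)
Lemma ge0_integral_lebdS n (f : n.+1.-tuple R -> \bar R) :
  measurable_fun [set: n.+1.-tuple R] f -> (forall x, 0 <= f x) ->
  \int[lebd n.+1]_x f x =
  \int[@lebesgue_measure R]_t \int[lebd n]_x f (cons_tuple t x).
Proof.
move=> mf f0; have [m mE] := lebd_measure n; rewrite (lebdS_E mE) mE.
rewrite /lebdS ge0_integral_pushforward//; last exact: measurable_consp.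
rewrite preimage_setT fubini_tonelli1//.
  by apply: measurableT_comp => //; exact: measurable_consp.
by move=> p /=; exact: f0.
Qed.

End lebd_measure.

(** * Volume of cubes *)

Section cube.
Variable R : realType.

(** The open ball of the sup norm. Its volume is explicit, so cubes inside and around Euclidean
    balls replace the volume of these balls in all estimates. *)
Definition cube n (x : n.-tuple R) (r : R) : set (n.-tuple R) :=
  [set y | forall i, `|tnth y i - tnth x i| < r].

Lemma measurable_cube n (x : n.-tuple R) r : measurable (cube x r).
Proof.
rewrite (_ : cube x r = \bigcap_(i in [set: 'I_n])
    ((fun y : n.-tuple R => tnth y i) @^-1` ball (tnth x i) r)).
  apply: fin_bigcap_measurable => // i _; rewrite -[X in measurable X]setTI.
  by apply: measurable_tnth => //; exact: measurable_ball.
apply/seteqP; split => y /=.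
  by move=> xy i _; rewrite /ball/= distrC.
by move=> xy i; have := xy i I; rewrite /ball/= distrC.
Qed.

Lemma tnth_liftE n (x : n.+1.-tuple R) (i : 'I_n) :
  tnth x (lift ord0 i) = tnth [tuple of behead x] i.
Proof. by rewrite [in LHS](tuple_eta x) tnthS. Qed.

Lemma lebd_cube n (x : n.-tuple R) r : 0 < r ->
  lebd n (cube x r) = ((r *+ 2) ^+ n)%:E.
Proof.
move=> r0; elim: n x => [|n IH] x /=.
  by rewrite indicE mem_set// => -[].
(* The slice at first coordinate t is a cube of one dimension less when t is within r of the first
   coordinate of x, and empty otherwise. *)
have -> : (fun t => lebd n [set y | cube x r (cons_tuple t y)]) =
    fun t => (((r *+ 2) ^+ n)%:E * (\1_(ball (tnth x ord0) r) t)%:E)%E.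
  apply/funext => t; rewrite indicE; have [xt|xt] := boolP (t \in _).
    rewrite mule1 -(IH [tuple of behead x]); congr lebd; apply/seteqP; split => y /=.
      move=> xy i; have := xy (lift ord0 i).
      by rewrite tnthS tnth_liftE.
    move=> xy i; case: (unliftP ord0 i) => [j|] ->.
      by rewrite tnthS tnth_liftE.
    by move: xt => /set_mem; rewrite /ball/= distrC.
  rewrite mule0 (_ : [set y | _] = set0).
    by have [m ->] := lebd_measure R n; rewrite measure0.
  apply/seteqP; split => // y /= /(_ ord0); rewrite tnth0 => xt'.
  by move/negP: xt; apply; rewrite mem_set// /ball/= distrC.
rewrite ge0_integralZl_EFin//; last 2 first.
- by apply/measurable_EFinP; apply: measurable_indic; exact: measurable_ball.
- by rewrite exprn_ge0// mulrn_wge0// ltW.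
rewrite integral_indic//; last exact: measurable_ball.
rewrite setIT exprSr EFinM; congr (_ * _)%E.
by apply: lebesgue_measure_ball; exact: ltW.
Qed.

End cube.

(** * Inner product and Euclidean norm *)

Section euclidean.
Variables (R : realType) (n : nat).
Implicit Types x y z : n.-tuple R.

Lemma enorm2 x : enorm x ^+ 2 = \sum_(i < n) tnth x i ^+ 2.
Proof. by rewrite sqr_sqrtr// sumr_ge0// => i _; exact: sqr_ge0. Qed.

Lemma enorm_ge0 x : 0 <= enorm x.
Proof. exact: sqrtr_ge0. Qed.

Definition edot x y : R := \sum_(i < n) tnth x i * tnth y i.

Lemma edotBr x y z : edot x (tsub y z) = edot x y - edot x z.
Proof.
by rewrite /edot -sumrB; apply: eq_bigr => i _; rewrite tnth_mktuple mulrBr.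
Qed.

Definition escale (c : R) x : n.-tuple R := [tuple c * tnth x i | i < n].

Lemma edotZl c x y : edot (escale c x) y = c * edot x y.
Proof. by rewrite mulr_sumr; apply: eq_bigr => i _; rewrite tnth_mktuple mulrA. Qed.

Lemma edotC x y : edot x y = edot y x.
Proof. by apply: eq_bigr => i _; rewrite mulrC. Qed.

Lemma edotxx x : edot x x = enorm x ^+ 2.
Proof. by rewrite enorm2; apply: eq_bigr => i _; rewrite expr2. Qed.

Lemma enorm_tsub2 x y :
  enorm (tsub x y) ^+ 2 = enorm x ^+ 2 - edot x y *+ 2 + enorm y ^+ 2.
Proof.
rewrite -edotxx edotBr [edot _ x]edotC [edot _ y]edotC !edotBr !edotxx (edotC y x).
by ring.
Qed.

Lemma enorm_unit x : 0 < enorm x ->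
  exists2 e, enorm e = 1 & edot e x = enorm x.
Proof.
move=> x0; exists (escale (enorm x)^-1 x); last first.
  by rewrite edotZl edotxx expr2 mulKf// gt_eqF.
apply/eqP; rewrite -(@eqrXn2 _ 2)// ?enorm_ge0//.
rewrite -edotxx edotZl edotC edotZl edotxx expr1n expr2; apply/eqP.
by field; rewrite gt_eqF.
Qed.

(** Cauchy-Schwarz against a unit vector: for c = <e, x>, the square |x - c e|^2 = |x|^2 - c^2 is
    nonnegative. *)
Lemma edot_le_enorm e x : enorm e = 1 -> edot e x <= enorm x.
Proof.
move=> e1; have [|/ltW ex] := leP (edot e x) 0.
  by move/le_trans; apply; exact: enorm_ge0.
rewrite -(@ler_pXn2r _ 2)// ?nnegrE ?enorm_ge0//.
set c := edot e x in ex *.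
have : 0 <= enorm (tsub x (escale c e)) ^+ 2 by exact: sqr_ge0.
rewrite enorm_tsub2 [edot x _]edotC edotZl -[enorm (escale _ _) ^+ 2]edotxx.
rewrite edotZl [edot e (escale _ _)]edotC edotZl edotxx e1 -/c => ?.
by nra.
Qed.

(** With e the unit vector along x, |x| - |y| <= <e, x> - <e, y> = <e, x - y> <= |x - y|. This is
    the Lipschitz property of the norm used in the tempered case. *)
Lemma enorm_tsub_ge x y : enorm x - enorm y <= enorm (tsub x y).
Proof.
have [|x0] := leP (enorm x) 0.
  move=> x0; rewrite (le_trans _ (enorm_ge0 _))// subr_le0.
  by rewrite (le_trans x0)// enorm_ge0.
have [e e1 ex] := enorm_unit x0.
have := edot_le_enorm y e1; have := edot_le_enorm (tsub x y) e1.
by rewrite edotBr ex; lra.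
Qed.

Lemma tsubC x y : enorm (tsub x y) = enorm (tsub y x).
Proof.
by congr Num.sqrt; apply: eq_bigr => i _; rewrite !tnth_mktuple -sqrrN opprB.
Qed.

End euclidean.

(** * Gaussian integrals *)

Section gauss.
Variable R : realType.

Lemma measurable_enorm_tsub2 n (v : n.-tuple R) :
  measurable_fun [set: n.-tuple R] (fun y => enorm (tsub y v) ^+ 2).
Proof.
under eq_fun do rewrite enorm2.
apply: measurable_sum => i; apply: measurable_funX.
under eq_fun do rewrite tnth_mktuple.
by apply: measurable_funB => //; exact: measurable_tnth.
Qed.

Lemma integral_expR_sqr (a : R) : 0 < a -> exists2 c : R, 0 < c &
  forall v, (\int[@lebesgue_measure R]_t (expR (- (a * (t - v) ^+ 2)))%:E = c%:E)%E.
Proof.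
(* The standard deviation for which the normal density has exponent -a (t - v)^2; the integral is
   then the inverse of its peak, whatever v is. *)
move=> a0; pose s := Num.sqrt ((a *+ 2)^-1).
have s2 : s ^+ 2 = (a *+ 2)^-1 by rewrite sqr_sqrtr// invr_ge0 mulrn_wge0// ltW.
have s0 : 0 < s by rewrite sqrtr_gt0 invr_gt0 mulrn_wgt0.
have p0 : 0 < normal_peak s by apply: normal_peak_gt0; rewrite gt_eqF.
exists (normal_peak s)^-1 => [|v]; first by rewrite invr_gt0.
transitivity ((normal_peak s)^-1%:E *
    \int[@lebesgue_measure R]_t (normal_pdf v s t)%:E)%E; last first.
  by rewrite integral_normal_pdf mule1.
rewrite -ge0_integralZl_EFin//; last 3 first.
- by move=> t _; rewrite lee_fin normal_pdf_ge0.
- by apply/measurable_EFinP; exact: measurable_normal_pdf.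
- by rewrite invr_ge0 ltW.
apply: eq_integral => t _; rewrite -EFinM /normal_pdf gt_eqF//.
rewrite mulKf ?gt_eqF// /normal_fun s2; congr (expR _)%:E.
by field; rewrite gt_eqF.
Qed.

Lemma integral_expR_enorm (a : R) : 0 < a -> exists2 c : R, 0 < c &
  forall n (v : n.-tuple R),
    (\int[lebd n]_y (expR (- (a * enorm (tsub y v) ^+ 2)))%:E = (c ^+ n)%:E)%E.
Proof.
move=> a0; have [c c0 cE] := integral_expR_sqr a0; exists c => //.
have mf n (v : n.-tuple R) : measurable_fun setT
    (fun y : n.-tuple R => (expR (- (a * enorm (tsub y v) ^+ 2)))%:E).
  apply/measurable_EFinP; apply: measurableT_comp => //.
  apply: measurableT_comp => //; apply: measurable_funM => //.
  exact: measurable_enorm_tsub2.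
elim=> [|n IH] v.
  have -> : (fun y : 0.-tuple R => (expR (- (a * enorm (tsub y v) ^+ 2)))%:E) = cst 1%E.
    apply/funext => y.
    by rewrite enorm2 big_ord0 mulr0 oppr0 expR0.
  have [m mE] := lebd_measure R 0; rewrite {1}mE integral_cst// mul1e.
  transitivity (lebd 0 [set: 0.-tuple R]); first by rewrite mE.
  by rewrite /= indicE in_setT.
rewrite ge0_integral_lebdS//.
have [m mE] := lebd_measure R n.
pose v' : n.-tuple R := [tuple of behead v].
(* The squared norm splits into the first coordinate and the rest, so the exponential factors; the
   rest integrates to c^n by induction. *)
transitivity (\int[@lebesgue_measure R]_t
    ((c ^+ n)%:E * (expR (- (a * (t - tnth v ord0) ^+ 2)))%:E))%E.
  apply: eq_integral => t _; rewrite muleC -(IH v') mE.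
  rewrite -ge0_integralZl_EFin ?expR_ge0//.
  - apply: eq_integral => y _; rewrite -EFinM -expRD; congr (expR _)%:E.
    rewrite -opprD -mulrDr; congr (- (_ * _)); rewrite !enorm2 big_ord_recl.
    rewrite !tnth_mktuple tnth0; congr (_ + _); apply: eq_bigr => i _.
    by rewrite !tnth_mktuple tnthS tnth_liftE.
  - exact: mf.
rewrite ge0_integralZl_EFin//.
- by rewrite cE -EFinM exprSr.
- apply/measurable_EFinP; apply: measurableT_comp => //.
  apply: measurableT_comp => //; apply: measurable_funM => //.
  by apply: measurable_funX; exact: measurable_funB.
- by rewrite exprn_ge0// ltW.
Qed.

End gauss.

(** * Euclidean balls between cubes *)

Section balls.
Variables (R : realType) (n : nat).
Implicit Types x y z : n.-tuple R.

Lemma enorm_tsub_triangle x y z :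
  enorm (tsub x z) <= enorm (tsub x y) + enorm (tsub y z).
Proof.
rewrite -lerBlDr; have := enorm_tsub_ge (tsub x z) (tsub y z).
suff -> : tsub (tsub x z) (tsub y z) = tsub x y by [].
by apply: eq_from_tnth => i; rewrite !tnth_mktuple; ring.
Qed.

Lemma tnth_le_enorm x i : `|tnth x i| <= enorm x.
Proof.
rewrite -(@ler_pXn2r _ 2)// ?nnegrE ?enorm_ge0// real_normK ?num_real//.
rewrite enorm2 (bigD1 i)//= lerDl sumr_ge0// => j _; exact: sqr_ge0.
Qed.

(** The sum of squares is at most n (r / (n+1))^2, and n < (n+1)^2. Dividing by n+1 also covers
    dimension 0. *)
Lemma enorm_lt x (r : R) : 0 < r -> (forall i, `|tnth x i| < r / n.+1%:R) -> enorm x < r.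
Proof.
move=> r0 xr; rewrite -(@ltr_pXn2r _ 2)// ?nnegrE ?enorm_ge0// ?ltW//.
have n0 : 0 < n.+1%:R :> R by rewrite ltr0n.
rewrite enorm2; apply: (@le_lt_trans _ _ (\sum_(i < n) (r / n.+1%:R) ^+ 2)).
  apply: ler_sum => i _; rewrite -[leLHS]real_normK ?num_real//.
  by rewrite ler_pXn2r// ?nnegrE ?ltW// divr_gt0.
rewrite sumr_const card_ord exprMn -mulrnAr gtr_pMr ?exprn_gt0//.
rewrite -mulr_natl exprVn ltr_pdivrMr ?exprn_gt0// mul1r -natrX ltr_nat.
by rewrite expnS expn1 (leq_trans (ltnSn n))// leq_pmulr.
Qed.

Lemma eball_sub_cube x h : eball x h `<=` cube x h.
Proof.
move=> y xy i; apply: le_lt_trans xy.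
by have := tnth_le_enorm (tsub y x) i; rewrite tnth_mktuple.
Qed.

Lemma cube_sub_eball x h : 0 < h -> cube x (h / n.+1%:R) `<=` eball x h.
Proof.
by move=> h0 y xy; apply: enorm_lt => // i; rewrite tnth_mktuple.
Qed.

End balls.

Lemma ge0_fine_le (R : realType) (x : \bar R) (r : R) :
  (0 <= x)%E -> (x <= r%:E)%E -> fine x <= r.
Proof. by case: x. Qed.

(** * Bounds on [mh], [Zh] and [nuh], and the support of the n-step kernel *)

Section kernel.
Variables (R : realType) (n : nat) (rho : n.-tuple R -> R).
Hypothesis rho_cont : econtinuous rho.
Hypothesis rho_pos : forall x, 0 < rho x.
Hypothesis rho_int : (\int[lebd n]_y (rho y)%:E = 1)%E.
Implicit Types (x y z : n.-tuple R) (D A : set (n.-tuple R)).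

Lemma le_integral_lebd D E (f g : n.-tuple R -> \bar R) :
  (forall x, D x -> 0 <= f x)%E -> (forall x, E x -> 0 <= g x)%E ->
  (forall x, D x -> E x /\ f x <= g x)%E ->
  (\int[lebd n]_(x in D) f x <= \int[lebd n]_(x in E) g x)%E.
Proof. have [m ->] := lebd_measure R n; exact: ge0_le_integral_sub. Qed.

Lemma integralZl_lebd_le D (f : n.-tuple R -> \bar R) (c : R) : 0 < c ->
  (forall x, D x -> 0 <= f x)%E ->
  (\int[lebd n]_(x in D) (c%:E * f x) <= c%:E * \int[lebd n]_(x in D) f x)%E.
Proof. have [m ->] := lebd_measure R n; exact: ge0_integralZl_le. Qed.

Lemma integral_cube_cst x r (c : R) : 0 < r ->
  (\int[lebd n]_(y in cube x r) c%:E = (c * (r *+ 2) ^+ n)%:E)%E.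
Proof.
move=> r0; rewrite EFinM -(lebd_cube x r0).
have [m ->] := lebd_measure R n.
by rewrite integral_cst//; exact: measurable_cube.
Qed.

Lemma mass_ge0 D : (0 <= \int[lebd n]_(y in D) (rho y)%:E)%E.
Proof.
have [m ->] := lebd_measure R n.
by apply: integral_ge0 => y _; rewrite lee_fin ltW.
Qed.

Lemma mass_le1 D : (\int[lebd n]_(y in D) (rho y)%:E <= 1)%E.
Proof.
by rewrite -rho_int; apply: le_integral_lebd => // y _; rewrite lee_fin ltW.
Qed.

(** [fine] sends infinity to 0; total mass 1 excludes this, so [mh] is the true mass of the ball. *)
Lemma mh_fineK h x :
  (\int[lebd n]_(y in eball x h) (rho y)%:E)%E = (mh rho h x)%:E.
Proof. by rewrite fineK// ge0_fin_numE ?mass_ge0// (le_lt_trans (mass_le1 _)) ?ltry. Qed.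

Lemma mh_ge0 h x : 0 <= mh rho h x.
Proof. by rewrite -lee_fin -mh_fineK mass_ge0. Qed.

Lemma mh_le1 h x : mh rho h x <= 1.
Proof. by rewrite -lee_fin -mh_fineK mass_le1. Qed.

Lemma mh_le h x K : 0 < h -> (forall y, eball x h y -> rho y <= K) ->
  mh rho h x <= K * (h *+ 2) ^+ n.
Proof.
move=> h0 rhoK; have K0 : 0 <= K.
  apply: (le_trans (ltW (rho_pos x))); apply: rhoK.
  by apply: cube_sub_eball => // i; rewrite subrr normr0 divr_gt0// ltr0n.
rewrite -lee_fin -mh_fineK -(integral_cube_cst x _ h0).
apply: le_integral_lebd => [y _|y _|y xy]; rewrite ?lee_fin//; first exact: ltW.
by split; [exact: eball_sub_cube|exact: rhoK].
Qed.

(** The radius r is separate from h because a lower bound on [rho] may be known only on a smaller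
    ball; the cube inscribed there supplies the volume. *)
Lemma mh_ge h r x c : 0 < r -> r <= h -> 0 <= c ->
  (forall y, eball x r y -> c <= rho y) ->
  c * (r / n.+1%:R *+ 2) ^+ n <= mh rho h x.
Proof.
move=> r0 rh c0 crho; have rn0 : 0 < r / n.+1%:R by rewrite divr_gt0// ltr0n.
rewrite -lee_fin -mh_fineK -(integral_cube_cst x _ rn0).
apply: le_integral_lebd => [y _|y _|y /(cube_sub_eball r0) xy].
- by rewrite lee_fin.
- by rewrite lee_fin ltW.
by split; [exact: lt_le_trans rh|rewrite lee_fin crho].
Qed.

Lemma rho_locally_ge x : exists2 r, 0 < r &
  forall y, eball x r y -> rho x / 2 <= rho y.
Proof.
have [|r r0 rP] := @rho_cont x (rho x / 2) _; first by rewrite divr_gt0.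
exists r => // y /rP; rewrite ltr_distl => /andP[+ _].
by move=> /ltW; apply: le_trans; rewrite {2}(splitr (rho x)) addrK.
Qed.

Lemma mh_gt0 h x : 0 < h -> 0 < mh rho h x.
Proof.
move=> h0; have [r r0 rP] := rho_locally_ge x.
have m0 : 0 < Num.min r h by rewrite lt_min r0.
apply: lt_le_trans (mh_ge m0 _ _ _); last first.
- by move=> y xy; apply: rP; apply: lt_le_trans xy _; rewrite ge_min lexx.
- by rewrite divr_ge0// ltW.
- by rewrite ge_min lexx orbT.
by rewrite mulr_gt0 ?divr_gt0// exprn_gt0// mulrn_wgt0// divr_gt0// ltr0n.
Qed.

(** Near the origin [rho] is at least half its value there, so [mh] is at least a constant times h^n
    on a fixed ball; integrating over a cube in that ball keeps the order h^n. *)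
Lemma Zh_ge : exists2 c, 0 < c & forall h, 0 < h -> h <= 1 -> c * h ^+ n <= Zh rho h.
Proof.
pose o : n.-tuple R := [tuple 0 | i < n].
have [r r0 rP] := rho_locally_ge o; have rho0 := rho_pos o.
(* Half for the distance of y from the origin, half for the ball about y: both together stay within
   r. *)
pose d := r / 2; have d0 : 0 < d by rewrite divr_gt0.
pose q := d / n.+1%:R *+ 2.
have q0 : 0 < q by rewrite mulrn_wgt0// divr_gt0// ltr0n.
have dn0 : 0 < d / n.+1%:R by rewrite divr_gt0// ltr0n.
(* The radius h d1 is at most h, as [mh_ge] requires, and at most d because h <= 1. *)
pose d1 := Num.min d 1; have d10 : 0 < d1 by rewrite lt_min d0 ltr01.
pose q1 := d1 / n.+1%:R *+ 2.
have q10 : 0 < q1 by rewrite mulrn_wgt0// divr_gt0// ltr0n.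
exists (rho o / 2 * q1 ^+ n * (rho o / 2) * q ^+ n).
  by rewrite !mulr_gt0// ?exprn_gt0// divr_gt0.
move=> h h0 h1.
have mge y : eball o d y -> rho o / 2 * (h * q1) ^+ n <= mh rho h y.
  move=> oy; have -> : h * q1 = h * d1 / n.+1%:R *+ 2 by rewrite /q1 mulrnAr mulrA.
  apply: mh_ge; first exact: mulr_gt0.
  - by rewrite ger_pMr// ge_min lexx orbT.
  - by rewrite divr_ge0// ltW.
  move=> z yz; apply: rP; apply: (le_lt_trans (enorm_tsub_triangle _ y _)).
  rewrite [r]splitr; apply: ltrD => //; apply: (lt_le_trans yz).
  rewrite (le_trans (ler_wpM2r (ltW d10) h1))// mul1r ge_min lexx//.
have -> : rho o / 2 * q1 ^+ n * (rho o / 2) * q ^+ n * h ^+ n =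
   rho o / 2 * (h * q1) ^+ n * (rho o / 2) * q ^+ n by rewrite exprMn; ring.
rewrite -lee_fin -(integral_cube_cst o _ dn0).
have Z0 (f : n.-tuple R -> R) : (forall y, 0 <= f y) -> (0 <= \int[lebd n]_y (f y)%:E)%E.
  by have [m ->] := lebd_measure R n => f0; apply: integral_ge0 => y _; rewrite lee_fin.
have mr0 y : 0 <= mh rho h y * rho y by rewrite mulr_ge0 ?mh_ge0// ltW.
rewrite fineK; last first.
  rewrite ge0_fin_numE ?Z0//; apply: le_lt_trans (ltry 1); rewrite -rho_int.
  apply: le_integral_lebd => y _; rewrite ?lee_fin//; first exact: ltW.
  by split=> //; rewrite ler_piMl ?mh_le1// ltW.
apply: le_integral_lebd => y; rewrite ?lee_fin//.
  move=> _; apply: mulr_ge0; last by rewrite divr_ge0// ltW.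
  by rewrite mulr_ge0 ?exprn_ge0 ?mulr_ge0 ?divr_ge0// ltW.
move=> /(cube_sub_eball d0) oy; split=> //.
apply: ler_pM.
- by rewrite mulr_ge0 ?exprn_ge0 ?mulr_ge0 ?divr_ge0// ltW.
- by rewrite divr_ge0// ltW.
- exact: mge.
- apply: rP; apply: (lt_le_trans oy); rewrite [leRHS]splitr lerDl ltW//.
Qed.

(** The h^n in the bound on m_h rho cancels against Z_h >= c h^n, leaving K = 1/c uniform in h, A
    and g. *)
Lemma nuh_le : exists2 K, 0 < K & forall h A (g : n.-tuple R -> R) P, 0 < h -> h <= 1 ->
  (forall y, A y -> mh rho h y * rho y <= h ^+ n * g y) ->
  (\int[lebd n]_(y in A) (g y)%:E <= P%:E)%E -> nuh rho h A <= K * P.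
Proof.
have [c c0 cZ] := Zh_ge; exists c^-1; first by rewrite invr_gt0.
move=> h A g P h0 h1 mg gP; have hn0 : 0 < h ^+ n by rewrite exprn_gt0.
have mr0 y : 0 <= mh rho h y * rho y by rewrite mulr_ge0 ?mh_ge0// ltW.
have g0 y : A y -> (0 <= (g y)%:E)%E.
  by move=> /mg /(le_trans (mr0 y)); rewrite pmulr_rge0.
have int0 (f : n.-tuple R -> R) : (forall y, A y -> 0 <= (f y)%:E)%E ->
    (0 <= \int[lebd n]_(y in A) (f y)%:E)%E.
  by have [m ->] := lebd_measure R n => f0; apply: integral_ge0 => y Ay; exact: f0.
have P0 : 0 <= P by rewrite -lee_fin; apply: le_trans gP; exact: int0.
have Zc := cZ h h0 h1; have Z0 : 0 < Zh rho h.
  by apply: lt_le_trans Zc; rewrite mulr_gt0.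
apply: (@le_trans _ _ ((Zh rho h)^-1 * (h ^+ n * P))).
  rewrite ler_pM2l ?invr_gt0//; apply: ge0_fine_le.
    by apply: int0 => y _; rewrite lee_fin.
  apply: (@le_trans _ _ (\int[lebd n]_(y in A) ((h ^+ n)%:E * (g y)%:E))%E).
    apply: le_integral_lebd => y Ay; rewrite -?EFinM ?lee_fin//.
      by rewrite (le_trans (mr0 y))// mg.
    by split=> //; exact: mg.
  apply: (le_trans (integralZl_lebd_le hn0 g0)).
  by rewrite EFinM lee_wpmul2l// lee_fin ltW.
rewrite mulrA ler_wpM2r// ler_pdivrMl// ler_pdivlMr//.
by rewrite mulrC.
Qed.

(** One step moves by less than h and so lowers phi by less than h. By induction the integrand is
    [rho] on the whole ball, and the quotient is m_h / m_h. *)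
Lemma Tn_eq1 (phi : n.-tuple R -> R) h s k x : 0 < h ->
  (forall x y, phi x - phi y <= enorm (tsub x y)) ->
  s + k%:R * h <= phi x -> Tn rho h k x [set y | s <= phi y] = 1.
Proof.
move=> h0 philip; elim: k x => [|k IH] x sx /=.
  by rewrite indicE mem_set//=; rewrite mul0r addr0 in sx.
have -> : (\int[lebd n]_(y in eball x h) (rho y * Tn rho h k y [set y | s <= phi y])%:E =
    \int[lebd n]_(y in eball x h) (rho y)%:E)%E.
  have [m ->] := lebd_measure R n.
  apply: eq_integral => y /set_mem xy; rewrite IH ?mulr1//.
  have := philip x y; rewrite tsubC; move: xy; rewrite /eball/= => xy.
  by move: sx; rewrite -natr1 mulrDl mul1r; lra.
by rewrite mulVf// gt_eqF// mh_gt0.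
Qed.

Lemma tvdist_ge (mu nu : set (n.-tuple R) -> R) A q : measurable A ->
  mu A = 1 -> nu A <= q -> ((1 - q)%:E <= tvdist mu nu)%E.
Proof.
move=> mA muA nuq; apply: (@le_trans _ _ `|mu A - nu A|%:E).
  by rewrite lee_fin muA (le_trans _ (ler_norm _))// lerB.
by apply: ereal_sup_ubound; exists A.
Qed.

End kernel.

(** * A Harnack inequality from logarithmic derivative bounds *)

Section harnack.
Variable R : realType.

(** The derivative of ln g is g'/g, bounded by C; the mean value theorem concludes. *)
Lemma ln_lipschitz (g : R -> R) (C : R) :
  (forall t, 0 < g t) -> (forall t, derivable g t 1) ->
  (forall t, `|derive1 g t| <= C * g t) ->
  forall s t, `|ln (g s) - ln (g t)| <= C * `|s - t|.
Proof.
move=> g0 dg gC s t; wlog st : s t / s <= t.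
  move=> W; have [/W//|/ltW/W] := leP s t.
  by rewrite distrC [`|t - s|]distrC.
have dln (u : R) : is_derive u (1 : R) (@ln R \o g) ((g u)^-1 * derive1 g u).
  apply: is_derive1_comp; first exact: is_derive1_ln.
  by rewrite derive1E; exact/derivableP.
have cln : {within `[s, t], continuous (@ln R \o g)}.
  by apply: derivable_within_continuous => u _; have [] := dln u.
have [u _ /= E] := MVT_segment st (fun u _ => dln u) cln.
rewrite distrC E normrM [`|s - t|]distrC ler_wpM2r//.
have gu : 0 <= (g u)^-1 by rewrite invr_ge0 ltW.
by rewrite normrM (ger0_norm gu) ler_pdivrMl// mulrC.
Qed.

Variable n : nat.
Implicit Types x y z : n.-tuple R.

(** The enumeration has no repetition, so exactly one partial derivative is taken. This extracts
    first-order bounds from those on all multi-indices. *)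
Lemma dmulti_delta (i : 'I_n) (f : n.-tuple R -> R) :
  dmulti (fun j => (j == i) : nat) f = partial i f.
Proof.
rewrite /dmulti; set F := fun j g => _.
have FE s : uniq s -> foldr F f s = if i \in s then partial i f else f.
  elim: s => //= j s IH /andP[js us]; rewrite {}IH// inE /F eq_sym.
  by have [->|] := eqVneq i j; [rewrite (negbTE js)|].
by rewrite FE ?enum_uniq// mem_enum.
Qed.

(** Moving one coordinate by at most 1 changes ln f by at most C, hence f by a factor at most e^C; n
    coordinates give L = e^(C n). *)
Lemma harnack (f : n.-tuple R -> R) : (forall x, 0 < f x) ->
  (forall i x, partial_derivable i f x) ->
  (forall i, exists2 C, 0 < C & forall x, `|partial i f x| <= C * f x) ->
  exists2 L, 0 < L &
    forall y z, (forall i, `|tnth z i - tnth y i| <= 1) -> f z <= L * f y.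
Proof.
move=> f0 df fC.
have [C CP] : exists C, forall i x, `|partial i f x| <= C * f x.
  have [c cP] := choice (fun i => let: ex_intro2 C _ h := fC i in ex_intro _ C h).
  exists (\sum_i `|c i|) => i x; apply: (le_trans (cP i x)).
  rewrite ler_wpM2r ?(ltW (f0 x))// (le_trans (ler_norm _))//.
  by rewrite (bigD1 i)//= lerDl sumr_ge0.
have tupdx x i : tupd x i (tnth x i) = x.
  by apply: eq_from_tnth => j; rewrite tnth_mktuple; case: eqP => [->|].
have tupdtupd x i s t : tupd (tupd x i s) i t = tupd x i t.
  by apply: eq_from_tnth => j; rewrite !tnth_mktuple; case: eqP.
have tnth_tupd x i s : tnth (tupd x i s) i = s by rewrite tnth_mktuple eqxx.
have step x i s t : `|s - t| <= 1 -> f (tupd x i s) <= expR C * f (tupd x i t).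
  move=> st; have f0' u := f0 (tupd x i u).
  have := @ln_lipschitz (fun u => f (tupd x i u)) C f0' _ _ s t.
  have C0 : 0 <= C.
    have := le_trans (normr_ge0 _) (CP i x).
    by rewrite pmulr_lge0.
  have -> : expR C * f (tupd x i t) = expR (C + ln (f (tupd x i t))).
    by rewrite expRD lnK// posrE.
  move=> H; rewrite -[leLHS]lnK ?posrE// ler_expR -lerBlDr.
  apply: le_trans (ler_norm _) _; apply: (le_trans (H _ _)).
  - move=> u; have := df i (tupd x i u); rewrite /partial_derivable tnth_tupd.
    by under eq_fun do rewrite tupdtupd.
  - move=> u; have := CP i (tupd x i u); rewrite /partial tnth_tupd.
    by under eq_fun do rewrite tupdtupd.
  - by rewrite ler_piMr.
exists (expR C ^+ n); first by rewrite exprn_gt0// expR_gt0.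
move=> y z yz.
(* A path from z (k = 0) to y (k = n) that replaces one coordinate at a time. *)
pose w k : n.-tuple R := [tuple if (j < k)%N then tnth y j else tnth z j | j < n].
have wE k : (k <= n)%N -> f z <= expR C ^+ k * f (w k).
  elim: k => [|k IH] kn.
    rewrite expr0 mul1r (_ : w 0%N = z)//.
    by apply: eq_from_tnth => j; rewrite tnth_mktuple.
  apply: (le_trans (IH (ltnW kn))).
  rewrite exprSr -mulrA ler_wpM2l ?exprn_ge0 ?expR_ge0//.
  pose i := Ordinal kn.
  have -> : w k = tupd (w k) i (tnth z i).
    rewrite -[LHS](tupdx _ i); congr tupd.
    by rewrite tnth_mktuple ltnn.
  have -> : w k.+1 = tupd (w k) i (tnth y i).
    apply: eq_from_tnth => j; rewrite !tnth_mktuple ltnS leq_eqVlt -val_eqE /=.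
    by case: eqP => // jk; congr tnth; exact: val_inj.
  exact: step.
apply: le_trans (wE n (leqnn n)) _; rewrite (_ : w n = y)//.
by apply: eq_from_tnth => j; rewrite tnth_mktuple ltn_ord.
Qed.

End harnack.

(** * Tails of the stationary measure *)

Section stationary_tail.
Variables (R : realType) (n : nat) (rho : n.-tuple R -> R).
Hypothesis rho_cont : econtinuous rho.
Hypothesis rho_pos : forall x, 0 < rho x.
Hypothesis rho_int : (\int[lebd n]_y (rho y)%:E = 1)%E.
Implicit Types (x y z e : n.-tuple R).

Lemma nuh_halfspace_gaussian (alpha beta : R) : 0 < alpha -> 0 < beta ->
  (forall x, rho x = beta * expR (- (alpha * enorm x ^+ 2))) ->
  exists2 C, 0 < C & forall h tau e, 0 < h -> h <= 1 -> 0 < tau -> enorm e = 1 ->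
    nuh rho h [set y | tau + h <= edot e y] <=
      C * expR (- (2 * alpha * tau * (tau - h))).
Proof.
move=> alpha0 beta0 rhoE.
have [K K0 KP] := nuh_le rho_cont rho_pos rho_int.
have [c c0 cP] := integral_expR_enorm alpha0.
pose B := beta ^+ 2 * 2 ^+ n; have B0 : 0 < B by rewrite mulr_gt0 ?exprn_gt0.
exists (K * (B * c ^+ n)); first by rewrite !mulr_gt0 ?exprn_gt0.
move=> h tau e h0 h1 tau0 e1.
pose s := tau + h; have s0 : 0 < s by rewrite addr_gt0.
(* The exponent in tau^2 comes from m_h and the one in s^2 from [rho]; B holds both factors beta and
   the 2^n of the cube volume (2h)^n. *)
pose E := B * expR (- (alpha * tau ^+ 2 + alpha * s ^+ 2)).
have E0 : 0 < E by rewrite mulr_gt0// expR_gt0.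
pose g y := E * expR (- (alpha * enorm (tsub y (escale s e)) ^+ 2)).
have g0 y : 0 <= g y by rewrite mulr_ge0 ?expR_ge0 ?ltW.
apply: (@le_trans _ _ (K * (E * c ^+ n))); last first.
  rewrite -[leRHS]mulrA ler_pM2l// [leRHS]mulrAC ler_pM2r ?exprn_gt0// ler_pM2l//.
  rewrite ler_expR lerN2 /s -subr_ge0.
  have -> : alpha * tau ^+ 2 + alpha * (tau + h) ^+ 2 - 2 * alpha * tau * (tau - h)
    = alpha * (4 * tau * h + h ^+ 2) by ring.
  by rewrite mulr_ge0 ?addr_ge0 ?sqr_ge0 ?mulr_ge0 ?ltW.
apply: (KP h _ g) => //; last first.
  rewrite EFinM -(cP n (escale s e)).
  apply: le_trans (integralZl_lebd_le E0 _) => [|y _]; last by rewrite lee_fin expR_ge0.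
  apply: le_integral_lebd => y _; rewrite -?EFinM ?lee_fin//; exact: g0.
move=> y sy.
have mhy : mh rho h y <= beta * expR (- (alpha * tau ^+ 2)) * (h *+ 2) ^+ n.
  apply: mh_le => // z yz; rewrite rhoE ler_pM2l// ler_expR lerN2 ler_pM2l//.
  rewrite ler_pXn2r// ?nnegrE ?enorm_ge0 ?ltW//.
  have := edot_le_enorm z e1; have := edot_le_enorm (tsub y z) e1.
  rewrite edotBr tsubC; move: yz sy; rewrite /eball/= => yz sy; lra.
have rhoy : rho y <= beta * (expR (- (alpha * s ^+ 2)) *
    expR (- (alpha * enorm (tsub y (escale s e)) ^+ 2))).
  rewrite rhoE ler_pM2l// -expRD ler_expR -opprD lerN2 -mulrDr ler_pM2l//.
  (* Expanding, |y - s e|^2 = |y|^2 - 2 s <e, y> + s^2, which is at most |y|^2 - s^2 since <e, y> >=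
     s. *)
  rewrite enorm_tsub2 edotC edotZl -(edotxx (escale s e)) edotZl.
  rewrite [edot e (escale _ _)]edotC edotZl.
  rewrite edotxx e1; move: sy; rewrite -/s /= => sy.
  by have := ler_wpM2l (ltW s0) sy; nra.
apply: (@le_trans _ _ _ _ _ (ler_pM (mh_ge0 _ _ _ _) (ltW (rho_pos y)) mhy rhoy)) => //.
rewrite /g /E /B opprD expRD -[h *+ 2]mulr_natr exprMn le_eqVlt.
by apply/orP; left; apply/eqP; ring.
Qed.

(** As h <= 1, the Harnack inequality holds across the ball and gives m_h rho <= L 2^n h^n rho^2;
    the domain is then enlarged to |y| >= tau. *)
Lemma nuh_tail_tempered (M : R) : (forall x, rho x <= M) -> tempered_exp rho ->
  exists2 C, 0 < C & forall h tau, 0 < h -> h <= 1 -> 0 < tau ->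
    nuh rho h [set y | tau + h <= enorm y] <=
      C * fine (\int[lebd n]_(y in [set y | (tau <= enorm y)%R]) (rho y ^+ 2)%R%:E)%E.
Proof.
move=> rhoM [rho_smooth [rho_dmulti _]].
have [K K0 KP] := nuh_le rho_cont rho_pos rho_int.
have [L L0 LP] : exists2 L, 0 < L &
    forall y z, (forall i, `|tnth z i - tnth y i| <= 1) -> rho z <= L * rho y.
  (* The empty list of derivatives in [smooth] stands for [rho] itself. *)
  apply: harnack => //; first by move=> i x; have [_] := rho_smooth [::]; exact.
  by move=> i; have := rho_dmulti (fun j => (j == i) : nat); rewrite dmulti_delta.
have B0 : 0 < L * 2 ^+ n by rewrite mulr_gt0// exprn_gt0.
exists (K * (L * 2 ^+ n)); first exact: mulr_gt0.
move=> h tau h0 h1 tau0; rewrite -mulrA.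
apply: (KP h _ (fun y => L * 2 ^+ n * rho y ^+ 2)) => //.
  move=> y _; have mhy : mh rho h y <= L * rho y * (h *+ 2) ^+ n.
    apply: mh_le => // z yz; apply: LP => i; apply: ltW.
    exact: lt_le_trans (eball_sub_cube yz i) h1.
  apply: le_trans (ler_wpM2r (ltW (rho_pos y)) mhy) _.
  by rewrite -[h *+ 2]mulr_natr exprMn le_eqVlt; apply/orP; left; apply/eqP; ring.
(* The integral of rho^2 is finite because rho^2 <= M rho; otherwise [fine] would turn the bound
   into 0. *)
rewrite EFinM fineK; last first.
  rewrite ge0_fin_numE; last first.
    have [m ->] := lebd_measure R n.
    by apply: integral_ge0 => y _; rewrite lee_fin sqr_ge0.
  have M0 : 0 < M by apply: lt_le_trans (rhoM [tuple 0 | i < n]).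
  apply: (@le_lt_trans _ _ (\int[lebd n]_y (M%:E * (rho y)%:E))%E).
    apply: le_integral_lebd => y; rewrite -?EFinM ?lee_fin ?sqr_ge0//.
      by rewrite mulr_ge0 ?ltW.
    by split=> //; rewrite expr2 ler_wpM2r// ltW.
  apply: le_lt_trans (integralZl_lebd_le M0 _) _; last by rewrite rho_int mule1 ltry.
  by move=> y _; rewrite lee_fin ltW.
apply: (@le_trans _ _ (\int[lebd n]_(y in [set y | (tau <= enorm y)%R])
    ((L * 2 ^+ n)%:E * (rho y ^+ 2)%:E))%E); last first.
  by apply: integralZl_lebd_le => // y _; rewrite lee_fin sqr_ge0.
apply: le_integral_lebd => y /=; rewrite ?lee_fin.
- by move=> _; rewrite mulr_ge0 ?sqr_ge0 ?ltW.
- by move=> _; rewrite mulr_ge0 ?sqr_ge0 ?ltW.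
- by move=> sy; split=> //; lra.
Qed.

End stationary_tail.

(** * Measurability of the test sets for total variation *)

Section measurable_levels.
Variables (R : realType) (n : nat).

Lemma measurable_superlevel (f : n.-tuple R -> R) s :
  measurable_fun setT f -> measurable [set y | s <= f y].
Proof.
move=> mf; have := mf measurableT _ (measurable_itv `[s, +oo[).
rewrite setTI; congr measurable; apply/seteqP; split => y /=;
  by rewrite in_itv/= andbT.
Qed.

Lemma measurable_edot (e : n.-tuple R) : measurable_fun setT (edot e).
Proof.
rewrite /edot; apply: measurable_sum => i; apply: measurable_funM => //.
exact: measurable_tnth.
Qed.

Lemma measurable_enorm : measurable_fun [set: n.-tuple R] (@enorm R n).
Proof.
rewrite /enorm; apply: measurableT_comp.
  by apply: continuous_measurable_fun; exact: sqrt_continuous.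
apply: measurable_sum => i.
by apply: measurable_funX; exact: measurable_tnth.
Qed.

End measurable_levels.

Theorem theorem5p2 (R : realType) (d : nat) (rho : d.-tuple R -> R)
  (rho_C1 : C1 rho)
  (rho_pos : forall x, 0 < rho x)
  (rho_bdd : exists M : R, forall x, rho x <= M)
  (rho_int : (\int[lebd d]_y (rho y)%:E = 1)%E) :
  (* Gaussian case *)
  (forall alpha beta : R, 0 < alpha -> 0 < beta ->
     (forall x, rho x = beta * expR (- (alpha * enorm x ^+ 2))) ->
     exists2 C : R, 0 < C &
       forall (n : nat) (h tau : R) (x : d.-tuple R),
         0 < h -> h <= 1 -> 0 < tau -> tau + n.+1%:R * h <= enorm x ->
         ((1 - C * expR (- (2 * alpha * tau * (tau - h))))%:E
            <= tvdist (Tn rho h n x) (nuh rho h))%E)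
  /\
  (* smooth tempered of exponential type case *)
  (tempered_exp rho ->
     exists2 C : R, 0 < C &
       forall (n : nat) (h tau : R) (x : d.-tuple R),
         0 < h -> h <= 1 -> 0 < tau -> tau + n.+1%:R * h <= enorm x ->
         ((1 - C * fine (\int[lebd d]_(y in [set y | (tau <= enorm y)%R]) (rho y ^+ 2)%R%:E)%E)%:E
            <= tvdist (Tn rho h n x) (nuh rho h))%E).

Proof.
have [rho_cont _] := rho_C1.
split=> [alpha beta alpha0 beta0 rhoE|rho_temp].
  have [C C0 CP] := nuh_halfspace_gaussian rho_cont rho_pos rho_int alpha0 beta0 rhoE.
  exists C => // n h tau x h0 h1 tau0 xtau.
  (* Since tau > 0, x is nonzero and has a direction e. *)
  have x0 : 0 < enorm x by apply: lt_le_trans xtau; rewrite addr_gt0// mulr_gt0.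
  have [e e1 ex] := enorm_unit x0.
  apply: (tvdist_ge _ _ (CP h tau e h0 h1 tau0 e1)).
    by apply: measurable_superlevel; exact: measurable_edot.
  apply: Tn_eq1 => //.
    by move=> y z; rewrite -edotBr; exact: edot_le_enorm.
  (* Of the n + 1 multiples of h, one raises the threshold to tau + h and the other n pay for the
     steps. *)
  by rewrite ex; move: xtau; rewrite -natr1 mulrDl; lra.
have [M rhoM] := rho_bdd.
have [C C0 CP] := nuh_tail_tempered rho_cont rho_pos rho_int rhoM rho_temp.
exists C => // n h tau x h0 h1 tau0 xtau.
apply: (tvdist_ge _ _ (CP h tau h0 h1 tau0)).
  by apply: measurable_superlevel; exact: measurable_enorm.
apply: Tn_eq1 => //; first exact: enorm_tsub_ge.
by move: xtau; rewrite -natr1 mulrDl; lra.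
Qed.
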